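(* Let $T\in\mathbb N$, let $A\ge2$ be the number of arms, let $c(1),\dots,c(A)\ge0$ be arm-dependent query costs, and let $B(1),\dots,B(T)>0$ be an arbitrary non-decreasing budget sequence. Let $\pi$ be a bandit strategy such that for every bandit instance and every $t\in\{1,\dots,T\}$ it holds that $\mathbb E[B^q(t)]\le B(t)$. Then there exists a bandit instance for which $$\mathbb E[\mathrm{Reg}(T)]\ge\frac{1}{140(1+\log T)}\sum_{t=1}^T\min\left\{\sqrt{\frac{\sum_{a=1}^Ac(a)}{B(t)(1+\log A)}},\,1\right\}.$$
   Context: Bandit model with reward queries. A bandit instance is a tuple $(\nu_a)_{a=1}^A$ of probability distributions on $[0,1]$ with means $r(a)$. At each round $t$ the agent chooses an arm $a_t$ and $q_t\in\{0,1\}$; a reward $R_t\sim\nu_{a_t}$ is generated independently of other rounds, and the agent observes only $Y_t=R_t\cdot q_t$. A bandit strategy $\pi$ chooses $(a_{t+1},q_{t+1})$ as a measurable function of $I_t=(U_0,Y_1,U_1,\dots,Y_t,U_t)$, where $U_0,U_1,\dots$ are i.i.d. uniform on $[0,1]$ (internal randomization). $B^q(t)=\sum_{k=1}^tc(a_k)\mathbf 1\{q_k=1\}$ is the total query cost up to round $t$ and $\mathrm{Reg}(T)=\sum_{t=1}^T(\max_ar(a)-r(a_t))$. *)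

(* Defs.v *)
From HB Require Import structures.
From mathcomp Require Import all_boot all_order all_algebra.
From mathcomp Require Import all_classical all_reals all_analysis.
From mathcomp Require Import measurable_realfun.

Set Implicit Arguments.
Unset Strict Implicit.
Unset Printing Implicit Defensive.
Import Order.TTheory GRing.Theory Num.Theory.
Import numFieldNormedType.Exports.

Local Open Scope classical_set_scope.
Local Open Scope ring_scope.

Section uniform.
Context (R : realType).

(* The library's uniform law lives on [measurableTypeR R], whose measurable sets
   are those of [R] (the Borel sets) under another display. *)
Let idTR : measurableTypeR R -> R := idfun.

#[local] HB.instance Definition _ :=
  @isMeasurableFun.Build _ _ _ _ idTR (@measurable_id _ _ setT).

Definition unif01 : probability R R :=
  distribution (uniform_prob (@ltr01 R)) idTR.

End uniform.

Record bandit_instance (R : realType) (A : nat) := BanditInstance {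
  arm_law :> 'I_A -> probability R R;
  arm_law01 : forall a, arm_law a `[0, 1]%classic = 1%E }.

(* [history R t] is used both for the information
   (U_0, ((Y_1, U_1), ..., (Y_t, U_t))) available to the agent after [t] rounds
   and for the underlying outcome (U_0, ((R_1, U_1), ..., (R_t, U_t))). *)
Definition history (R : realType) (t : nat) : Type := (R * t.-tuple (R * R))%type.
HB.instance Definition _ (R : realType) (t : nat) :=
  Measurable.on (history R t).

(* [decide t] maps I_t to (a_{t+1}, q_{t+1}). It is measurable for the discrete
   sigma-algebra on ['I_A * bool], spelled out because ['I_A] is not pointed. *)
Record strategy (R : realType) (A : nat) := Strategy {
  decide : forall t, history R t -> 'I_A * bool;
  measurable_decide : forall t (D : set ('I_A * bool)),
    measurable (@decide t @^-1` D) }.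

Definition snoc (R : realType) n (w : history R n) (z : R * R) : history R n.+1 :=
  (w.1, [tuple of rcons w.2 z]).

Section interaction.
Context (R : realType) (A : nat) (pi : strategy R A).

(* In [reward], [rand_after], [arm] and [query], index [t] refers to round t + 1:
   they return R_{t+1}, U_{t+1}, a_{t+1} and q_{t+1}. *)
Definition reward n (w : history R n) (t : nat) : R := (nth (0, 0) w.2 t).1.

Definition rand_after n (w : history R n) (t : nat) : R := (nth (0, 0) w.2 t).2.

(* I_t as a function of the outcome, with Y_{t+1} = R_{t+1} * q_{t+1}. *)
Fixpoint info n (w : history R n) (t : nat) : history R t :=
  if t is s.+1 then
    snoc (info w s)
      (reward w s * (decide pi (info w s)).2%:R, rand_after w s)
  else (w.1, [tuple]).

Definition arm n (w : history R n) (t : nat) : 'I_A := (decide pi (info w t)).1.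

Definition query n (w : history R n) (t : nat) : bool :=
  (decide pi (info w t)).2.

End interaction.

Section measurability.
Context (R : realType) (A : nat) (pi : strategy R A).

Lemma measurable_nth_history n i :
  measurable_fun [set: history R n] (fun w => nth (0, 0) w.2 i).
Proof.
have [ni|ni] := leqP n i.
  rewrite (_ : (fun _ => _) = cst (0, 0)) //.
  by apply/funext => w; rewrite nth_default// size_tuple.
rewrite (_ : (fun _ => _) = (fun x => tnth x (Ordinal ni)) \o snd).
  apply: measurableT_comp; last exact: measurable_snd.
  exact: measurable_tnth.
by apply/funext => w /=; rewrite (tnth_nth (0, 0)).
Qed.

Lemma measurable_snoc d (T : measurableType d) n (f : T -> history R n)
    (g : T -> R * R) :
  measurable_fun [set: T] f -> measurable_fun [set: T] g ->
  measurable_fun [set: T] (fun x => snoc (f x) (g x)).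
Proof.
move=> mf mg; apply/measurable_fun_pairP; split.
  by rewrite /comp/=; exact: (measurableT_comp measurable_fst mf).
apply/measurable_fun_tnthP => i.
have [ni|ni] := ltnP i n.
  rewrite (_ : _ \o _ = (fun x => tnth x (Ordinal ni)) \o (snd \o f)).
    apply: measurableT_comp; first exact: measurable_tnth.
    exact: (measurableT_comp measurable_snd mf).
  apply/funext => x /=.
  by rewrite !(tnth_nth (0, 0))/= nth_rcons size_tuple ni.
have -> : i = ord_max.
  by apply/val_inj/eqP => /=; rewrite eqn_leq ni -ltnS ltn_ord.
rewrite (_ : _ \o _ = g)//; apply/funext => x /=.
by rewrite (tnth_nth (0, 0))/= nth_rcons size_tuple ltnn eqxx.
Qed.

Lemma measurable_info n t : measurable_fun [set: history R n] (fun w => info pi w t).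
Proof.
elim: t => [|t IH] /=.
  apply/measurable_fun_pairP; split; first exact: measurable_fst.
  by apply/measurable_fun_tnthP => -[].
apply: measurable_snoc => //.
apply/measurable_fun_pairP; split; last first.
  exact: (measurableT_comp measurable_snd (@measurable_nth_history n t)).
apply: measurable_funM.
  exact: (measurableT_comp measurable_fst (@measurable_nth_history n t)).
apply: (@measurableT_comp _ _ _ _ _ _ (fun b : bool => b%:R : R)) => //.
move=> _ D _; rewrite setTI.
rewrite [X in measurable X](_ : _ = (fun w => info pi w t) @^-1`
  (@decide _ _ pi t @^-1` [set x | D x.2]))//.
by rewrite -[X in measurable X]setTI; apply: IH => //; exact: measurable_decide.
Qed.

Lemma measurable_arm n t (a : 'I_A) :
  measurable [set w : history R n | arm pi w t = a].
Proof.
rewrite [X in measurable X](_ : _ = (fun w => info pi w t) @^-1`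
  (@decide _ _ pi t @^-1` [set x | x.1 = a]))//.
rewrite -[X in measurable X]setTI.
by apply: measurable_info => //; exact: measurable_decide.
Qed.

End measurability.

Section law.
Context (R : realType) (A : nat) (nu : bandit_instance R A) (pi : strategy R A).

Definition mean (a : 'I_A) : R := \int[nu a]_x x.

(* The means lie in [0, 1], so starting the maximum at 0 is harmless. *)
Definition max_mean : R := \big[Num.max/0]_(a < A) mean a.

Definition round_law (a : 'I_A) : probability (R * R)%type R :=
  (nu a \x unif01 R)%E.

Section step.
Context (n : nat) (P : probability (history R n) R).
Local Open Scope ereal_scope.

(* Law of the outcome of n + 1 rounds when [P] is that of the first n: given the
   past, R_{n+1} has law nu_{a_{n+1}} and U_{n+1} is uniform and independent. *)
Definition step (S : set (history R n.+1)) : \bar R :=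
  \int[P]_w round_law (arm pi w n) (snoc w @^-1` S).

Let measurable_section w (S : set (history R n.+1)) :
  measurable S -> measurable (snoc w @^-1` S).
Proof.
move=> mS; rewrite -[X in measurable X]setTI.
have mw : measurable_fun [set: R * R] (snoc w).
  by apply: (@measurable_snoc _ _ _ n (fun=> w) id).
exact: mw.
Qed.

Let measurable_integrand (S : set (history R n.+1)) : measurable S ->
  measurable_fun [set: history R n]
    (fun w => round_law (arm pi w n) (snoc w @^-1` S)).
Proof.
move=> mS _ Y mY; rewrite setTI.
pose F a w := round_law a (snoc w @^-1` S).
have mF a : measurable_fun [set: history R n] (F a).
  pose S' := (fun p : history R n * (R * R) => snoc p.1 p.2) @^-1` S.
  have mS' : measurable S'.
    rewrite -[X in measurable X]setTI.
    have m2 : measurable_fun [set: history R n * (R * R)]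
        (fun p => snoc p.1 p.2).
      by apply: (@measurable_snoc _ _ _ n fst snd).
    exact: m2.
  rewrite (_ : F a = round_law a \o xsection S').
    exact: (measurable_fun_xsection (round_law a)).
  by apply/funext => w; rewrite /F /= xsectionE.
rewrite [X in measurable X](_ : _ =
    \bigcup_(a in [set: 'I_A]) ([set w | arm pi w n = a] `&` F a @^-1` Y)).
  apply: fin_bigcup_measurable => // a _; apply: measurableI.
    exact: measurable_arm.
  by rewrite -[X in measurable X]setTI; exact: mF.
by apply/seteqP; split => [w Yw|w [a _ [<- //]]]; exists (arm pi w n).
Qed.

Let step0 : step set0 = 0.
Proof. by apply: integral0_eq => w _; rewrite preimage_set0 measure0. Qed.

Let step_ge0 S : 0 <= step S.
Proof. exact: integral_ge0. Qed.

Let step_sigma_additive : semi_sigma_additive step.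
Proof.
move=> F mF tF mUF; rewrite [X in _ --> X](_ : _ =
  \int[P]_w (\sum_(i <oo)
     round_law (arm pi w n) (snoc w @^-1` (F i)))); last first.
  apply: eq_integral => w _; rewrite preimage_bigcup; apply/esym/cvg_lim => //.
  apply: measure_semi_sigma_additive.
  - by move=> i; exact: measurable_section.
  - apply/trivIsetP => i j _ _ ij; rewrite -preimage_setI.
    by move/trivIsetP: tF => -> //; rewrite preimage_set0.
  - by apply: bigcup_measurable => i _; exact: measurable_section.
rewrite integral_nneseries//; last by move=> i; exact: measurable_integrand.
by apply: is_cvg_nneseries => i _ _; exact: step_ge0.
Qed.

HB.instance Definition _ :=
  isMeasure.Build _ _ _ step step0 step_ge0 step_sigma_additive.

Let step_setT : step [set: history R n.+1] = 1.
Proof.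
rewrite /step (eq_integral (cst 1))//; last first.
  by move=> w _; rewrite preimage_setT; exact: probability_setT.
rewrite integral_cst// mul1e; exact: probability_setT.
Qed.

HB.instance Definition _ := Measure_isProbability.Build _ _ _ step step_setT.

Definition law_step : probability (history R n.+1) R := step.

End step.

Let start (u : R) : history R 0 := (u, [tuple]).

Let measurable_start : measurable_fun [set: R] start.
Proof.
apply/measurable_fun_pairP; split; first exact: measurable_id.
by apply/measurable_fun_tnthP => -[].
Qed.

#[local] HB.instance Definition _ :=
  isMeasurableFun.Build _ _ _ _ start measurable_start.

Definition law0 : probability (history R 0) R := distribution (unif01 R) start.

Fixpoint bandit_law n : probability (history R n) R :=
  if n is m.+1 then law_step (bandit_law m) else law0.

End law.

Section quantities.
Context (R : realType) (A : nat) (pi : strategy R A).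

Definition query_cost (c : 'I_A -> R) (t : nat) n (w : history R n) : R :=
  \sum_(k < t) c (arm pi w k) * (query pi w k)%:R.

Definition regret (nu : bandit_instance R A) (T : nat) n (w : history R n) : R :=
  \sum_(k < T) (max_mean nu - mean nu (arm pi w k)).

End quantities.

(* Main.v *)
(* Compare the instance whose arms are all fair coins with the 2A instances in
   which one arm a has bias +d or -d. If under the fair instance the agent queries
   a only N times on average, then up to an error 1/4 + 8 d^2 N it cannot tell
   whether a is the best or the worst arm, so in every round it misses a in the
   first case or plays it in the second, and loses d/2. Averaging over a with
   weight c(a) / sum c makes the mean of N at round t at most B(t) / sum c. Hence
   with d = m_s / 8, where m_t = min(sqrt(sum c / B(t)), 1), every round t <= s
   costs a constant times m_s on average. For the s maximising s m_s, the bound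
   sum_t m_t <= s m_s sum_t 1/t loses only the factor 1 + log T. *)
From HB Require Import structures.
Require Import Defs.
From mathcomp Require Import all_boot all_order all_algebra.
From mathcomp Require Import all_classical all_reals all_analysis.
From mathcomp Require Import measurable_realfun giry ring lra.

Import Order.TTheory GRing.Theory Num.Theory.
Set Implicit Arguments.
Unset Strict Implicit.
Unset Printing Implicit Defensive.
Local Open Scope classical_set_scope.
Local Open Scope ring_scope.

(** * Integration against the law of one more round *)

Section bind.
Local Open Scope ereal_scope.
Context d d' (Y : measurableType d) (Z : measurableType d') (R : realType).
Variables (P : probability Y R) (K : Y -> probability Z R) (Q : probability Z R).

(** The first two hypotheses make [Q] the Giry bind of [P] with the kernel [K]. They are stated
    setwise because [step] is defined directly as an integral. *)
Lemma ge0_integral_bind (f : Z -> \bar R) :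
  (forall S, measurable S -> measurable_fun [set: Y] (fun y => K y S)) ->
  (forall S, measurable S -> Q S = \int[P]_y K y S) ->
  measurable_fun [set: Z] f -> (forall z, 0 <= f z) ->
  \int[Q]_z f z = \int[P]_y \int[K y]_z f z.
Proof.
move=> mK QE mf f0.
pose k y : giry Z R := K y.
have mk : measurable_fun [set: Y] k by exact: measurable_giry_codensity.
transitivity (giry_int (giry_bind P mk) f); last by rewrite giry_int_bind.
apply: eq_measure_integral => S mS _ /=.
rewrite QE// /giry_ev.
rewrite [RHS]/(giry_int _ _) [RHS]giry_int_map//; exact: measurable_giry_ev.
Qed.
End bind.

Section select.
Context d d' (T : measurableType d) (T' : sigmaRingType d') (I : finType).
Variable D : T -> I.
Hypothesis mD : forall i, measurable [set x | D x = i].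

(** A preimage splits into finitely many pieces on which [D] is constant. As [I] carries no
    sigma-algebra, measurability of [D] is expressed through its fibres. *)
Lemma measurable_fun_select (F : I -> T -> T') :
  (forall i, measurable_fun [set: T] (F i)) ->
  measurable_fun [set: T] (fun x => F (D x) x).
Proof.
move=> mF _ Y mY; rewrite setTI.
rewrite [X in measurable X](_ : _ =
    \bigcup_(i in [set: I]) ([set x | D x = i] `&` F i @^-1` Y)).
  apply: fin_bigcup_measurable => // i _; apply: measurableI; first exact: mD.
  by rewrite -[X in measurable X]setTI; exact: mF.
by apply/seteqP; split => [x Yx|x [i _ [<- //]]]; exists (D x).
Qed.

End select.

Lemma measurable_integral_select d d' (T : measurableType d)
    (Z : measurableType d') (R : realType) (I : finType) (D : T -> I)
    (P : I -> probability Z R) (F : T -> Z -> \bar R) :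
  (forall i, measurable [set x | D x = i]) ->
  measurable_fun [set: T * Z] (fun p => F p.1 p.2) ->
  (forall x z, 0 <= F x z)%E ->
  measurable_fun [set: T] (fun x => \int[P (D x)]_z F x z)%E.
Proof.
move=> mD mF F0.
apply: (@measurable_fun_select _ _ _ _ _ D mD (fun i x => \int[P i]_z F x z)%E).
move=> i.
by apply: (@measurable_fun_fubini_tonelli_F _ _ _ _ _ (P i) (fun p => F p.1 p.2)).
Qed.

Section law_step.
Context (R : realType) (A : nat) (nu : bandit_instance R A) (pi : strategy R A).
Context (n : nat).

Lemma measurable_snoc_pair :
  measurable_fun [set: history R n * (R * R)] (fun p => snoc p.1 p.2).
Proof. by apply: (@measurable_snoc _ _ _ n fst snd). Qed.

Lemma measurable_snoc_at (w : history R n) :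
  measurable_fun [set: R * R] (snoc w).
Proof. by apply: (@measurable_snoc _ _ _ n (fun=> w) id). Qed.

Local Open Scope ereal_scope.

Lemma ge0_integral_law_step (P : probability (history R n) R)
    (f : history R n.+1 -> \bar R) :
  measurable_fun [set: history R n.+1] f -> (forall w, 0 <= f w) ->
  \int[law_step nu pi P]_w f w =
  \int[P]_w \int[round_law nu (arm pi w n)]_z f (snoc w z).
Proof.
move=> mf f0.
(* The kernel of the bind is the image of the round law under [snoc w]. *)
pose s (w : history R n) : {mfun _ >-> _} :=
  HB.pack (snoc w) (isMeasurableFun.Build _ _ _ _ _ (measurable_snoc_at w)).
pose K w : probability _ R := distribution (round_law nu (arm pi w n)) (s w).
rewrite (@ge0_integral_bind _ _ _ _ _ P K)//.
- by apply: eq_integral => w _; rewrite ge0_integral_pushforward//;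
    exact: measurable_snoc_at.
- move=> S mS.
  apply: (@measurable_fun_select _ _ _ _ _ (fun w => arm pi w n) _
    (fun a w => round_law nu a (snoc w @^-1` S))) => a.
    exact: measurable_arm.
  pose S' := (fun p : history R n * (R * R) => snoc p.1 p.2) @^-1` S.
  have mS' : measurable S'.
    by rewrite -[X in measurable X]setTI; exact: measurable_snoc_pair.
  rewrite (_ : (fun _ => _) = round_law nu a \o xsection S').
    exact: (measurable_fun_xsection (round_law nu a)).
  by apply/funext => w /=; rewrite xsectionE.
Qed.

End law_step.

(** * Bernoulli arms *)

Section coin.
Context (R : realType).

Definition indicR (b : bool) : R := b%:R.

#[local] HB.instance Definition _ :=
  @isMeasurableFun.Build _ _ _ _ indicR (fun _ _ _ => I).

Definition coin (p : R) : probability R R :=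
  distribution (bernoulli_prob p) indicR.

Local Open Scope ereal_scope.

Lemma ge0_integral_coin (p : R) (f : R -> \bar R) : (0 <= p <= 1)%R ->
  measurable_fun [set: R] f -> (forall x, 0 <= f x) ->
  \int[coin p]_x f x = p%:E * f 1%R + (1 - p)%:E * f 0%R.
Proof.
move=> p01 mf f0; rewrite ge0_integral_pushforward// preimage_setT.
by rewrite integral_bernoulli_prob//=.
Qed.

(** Both outcomes lie in the interval whatever [p] is, so [coin_instance] can be formed from any
    family of reals. *)
Lemma coin_unit_interval (p : R) : coin p `[0%R, 1%R]%classic = 1.
Proof.
rewrite -[RHS](probability_setT (coin p)) /=.
rewrite /distribution /pushforward; congr (bernoulli_prob p _).
by apply/seteqP; split => // -[] _ /=; rewrite in_itv /= ?lexx ?ler01.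
Qed.

Definition coin_instance A (p : 'I_A -> R) : bandit_instance R A :=
  BanditInstance (fun a => coin_unit_interval (p a)).

Lemma mean_coin A (p : 'I_A -> R) a : (0 <= p a <= 1)%R ->
  mean (coin_instance p) a = p a.
Proof.
move=> p01; rewrite /mean /Rintegral integralE.
(* The integral formula for coins covers nonnegative functions, so it is applied to the positive and
   negative parts of the identity. *)
have mE : measurable_fun [set: R] (@EFin R). exact/measurable_EFinP.
rewrite !ge0_integral_coin//; last 2 first.
- exact: measurable_funeneg.
- exact: measurable_funepos.
rewrite !funeposE !funenegE -!EFinN -!EFin_max -!EFinM -!EFinD /=.
have N10 : (- 1 <= 0 :> R)%R by rewrite oppr_le0 ler01.
rewrite oppr0 !maxxx (max_l (@ler01 R)) (max_r N10).
by rewrite !mulr0 mulr1 !addr0 subr0.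
Qed.

Lemma ge0_integral_round_coin A (p : 'I_A -> R) a (f : R * R -> \bar R) :
  (0 <= p a <= 1)%R ->
  measurable_fun [set: R * R] f -> (forall z, 0 <= f z) ->
  \int[round_law (coin_instance p) a]_z f z =
  (p a)%:E * (\int[unif01 R]_u f (1%R, u)) +
  (1 - p a)%:E * (\int[unif01 R]_u f (0%R, u)).
Proof.
move=> p01 mf f0; rewrite (fubini_tonelli1 f)//= ge0_integral_coin//.
- exact: measurable_fun_fubini_tonelli_F.
- by move=> x; apply: integral_ge0.
Qed.

End coin.

Lemma integral_probability_cst d (T : measurableType d) (R : realType)
    (P : probability T R) (r : R) : (\int[P]_x r%:E = r%:E)%E.
Proof.
by rewrite integral_cst// -[RHS]mule1; congr (_ * _)%E; exact: probability_setT.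
Qed.

(** * Effect of an appended round on a history *)

Section snoc.
Context (R : realType) (A : nat) (pi : strategy R A) (n : nat).
Implicit Types (w : history R n) (z : R * R).

Lemma reward_snoc w z k : (k < n)%N -> reward (snoc w z) k = reward w k.
Proof. by move=> kn; rewrite /reward/= nth_rcons size_tuple kn. Qed.

Lemma reward_snoc_last w z : reward (snoc w z) n = z.1.
Proof. by rewrite /reward/= nth_rcons size_tuple ltnn eqxx. Qed.

Lemma info_snoc w z t : (t <= n)%N -> info pi (snoc w z) t = info pi w t.
Proof.
elim: t => [//|t IH] tn /=; rewrite IH ?(ltnW tn)// reward_snoc//.
by rewrite /rand_after/= nth_rcons size_tuple tn.
Qed.

(** Index k is the arm of round k + 1, chosen from the first k rounds, so k = n is allowed here but
    not in [reward_snoc]. *)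
Lemma arm_snoc w z k : (k <= n)%N -> arm pi (snoc w z) k = arm pi w k.
Proof. by move=> kn; rewrite /arm info_snoc. Qed.

Lemma query_snoc w z k : (k <= n)%N -> query pi (snoc w z) k = query pi w k.
Proof. by move=> kn; rewrite /query info_snoc. Qed.

Lemma info_snoc_last w z : info pi (snoc w z) n.+1 =
  snoc (info pi w n) (z.1 * (query pi w n)%:R, z.2).
Proof.
rewrite /= info_snoc// reward_snoc_last /rand_after/= nth_rcons size_tuple.
by rewrite ltnn eqxx.
Qed.

Lemma measurable_fun_decide d (T : sigmaRingType d) (f : 'I_A * bool -> T) :
  measurable_fun [set: history R n] (fun h => f (decide pi h)).
Proof.
move=> _ Y _; rewrite setTI.
exact: (@measurable_decide _ _ pi n [set x | Y (f x)]).
Qed.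

Lemma measurable_reward k :
  measurable_fun [set: history R n] (fun w => reward w k).
Proof.
exact: (measurableT_comp measurable_fst (@measurable_nth_history R n k)).
Qed.

End snoc.

Lemma measurable_decision (R : realType) A (pi : strategy R A) n d
    (T : sigmaRingType d) (f : 'I_A * bool -> T) t :
  measurable_fun [set: history R n] (fun w => f (decide pi (info pi w t))).
Proof.
move=> mT Y mY; rewrite setTI -[X in measurable X]setTI.
apply: (@measurable_info R A pi n t _
  ((fun h => f (decide pi h)) @^-1` Y)) => //.
by rewrite -[X in measurable X]setTI; exact: measurable_fun_decide.
Qed.

(** * Consistency of the laws for different horizons *)

Section marginal.
Context (R : realType) (A : nat) (nu : bandit_instance R A) (pi : strategy R A).
Local Open Scope ereal_scope.

Lemma ge0_integral_bandit_lawS n (f : history R n.+1 -> \bar R) :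
  measurable_fun [set: history R n.+1] f -> (forall w, 0 <= f w) ->
  \int[bandit_law nu pi n.+1]_w f w =
  \int[bandit_law nu pi n]_w \int[round_law nu (arm pi w n)]_z f (snoc w z).
Proof. exact: ge0_integral_law_step. Qed.

(** Each round after t integrates out with mass 1. Histories of different lengths have different
    types, so [F] is a family, and its last hypothesis says that it ignores the rounds after t. *)
Lemma ge0_integral_bandit_law_prefix (F : forall n, history R n -> \bar R) t n :
  (t <= n)%N ->
  (forall n, measurable_fun [set: history R n] (F n)) ->
  (forall n w, 0 <= F n w) ->
  (forall n w z, (t <= n)%N -> F n.+1 (snoc w z) = F n w) ->
  \int[bandit_law nu pi n]_w F n w = \int[bandit_law nu pi t]_w F t w.
Proof.
move=> tn mF F0 Fsnoc; rewrite -(subnK tn); move: (n - t)%N => k.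
elim: k => [//|k IH]; rewrite addSn -IH ge0_integral_bandit_lawS//.
apply: eq_integral => w _.
rewrite (eq_integral (cst (F _ w))); last first.
  by move=> z _; rewrite Fsnoc ?leq_addl.
by rewrite integral_cst// -[X in _ * X]/(round_law _ _ setT) probability_setT mule1.
Qed.

End marginal.

(** * Observed tosses of one arm: count, random walk and likelihood ratio *)

Section observations.
Context (R : realType) (A : nat) (pi : strategy R A) (a : 'I_A).

Definition observed n (w : history R n) (k : nat) : bool :=
  (arm pi w k == a) && query pi w k.

(* Equal to 2 x - 1 at the rewards 0 and 1 of a coin, but bounded everywhere. *)
Definition toss (x : R) : R := if x == 1 then 1 else -1.

Definition observations (t : nat) n (w : history R n) : R :=
  \sum_(k < t) (observed w k)%:R.

(** Under fair coins this is a martingale, with steps 1 or -1 in the rounds that query [a] and 0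
    elsewhere. *)
Definition walk (t : nat) n (w : history R n) : R :=
  \sum_(k < t) toss (reward w k) * (observed w k)%:R.

(** Density of the biased law against the fair one on the observed information: a queried toss of
    [a] contributes ((1 + d)/2)/(1/2) or ((1 - d)/2)/(1/2). *)
Definition likelihood_ratio (d : R) (t : nat) n (w : history R n) : R :=
  \prod_(k < t) (1 + d * (toss (reward w k) * (observed w k)%:R)).

Lemma observed_snoc n (w : history R n) z k : (k <= n)%N ->
  observed (snoc w z) k = observed w k.
Proof. by move=> kn; rewrite /observed arm_snoc// query_snoc. Qed.

Lemma observations_snoc t n (w : history R n) z : (t <= n.+1)%N ->
  observations t (snoc w z) = observations t w.
Proof.
move=> tn; apply: eq_bigr => k _; rewrite observed_snoc//.
by rewrite -ltnS (leq_trans (ltn_ord k)).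
Qed.

Lemma walk_snoc n (w : history R n) z :
  walk n.+1 (snoc w z) = walk n w + toss z.1 * (observed w n)%:R.
Proof.
rewrite /walk big_ord_recr/= reward_snoc_last observed_snoc//; congr (_ + _).
apply: eq_bigr => k _; rewrite reward_snoc// observed_snoc// ltnW//.
Qed.

Lemma likelihood_ratio_snoc d n (w : history R n) z :
  likelihood_ratio d n.+1 (snoc w z) =
  likelihood_ratio d n w * (1 + d * (toss z.1 * (observed w n)%:R)).
Proof.
rewrite /likelihood_ratio big_ord_recr/= reward_snoc_last observed_snoc//.
congr (_ * _).
apply: eq_bigr => k _; rewrite reward_snoc// observed_snoc// ltnW//.
Qed.

Lemma measurable_observed n k :
  measurable_fun [set: history R n] (fun w => (observed w k)%:R : R).
Proof.
exact: (@measurable_decision R A pi n _ R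
  (fun x => ((x.1 == a) && x.2)%:R)).
Qed.

Lemma measurable_toss : measurable_fun [set: R] toss.
Proof. by apply: measurable_fun_ifT => //; exact: measurable_fun_eqr. Qed.

Lemma measurable_walk_increment n k : measurable_fun [set: history R n]
  (fun w => toss (reward w k) * (observed w k)%:R).
Proof.
apply: measurable_funM; last exact: measurable_observed.
exact: (measurableT_comp measurable_toss (@measurable_reward R n k)).
Qed.

Lemma measurable_observations t n :
  measurable_fun [set: history R n] (fun w => observations t w).
Proof. by apply: measurable_sum => k; exact: measurable_observed. Qed.

Lemma measurable_walk t n :
  measurable_fun [set: history R n] (fun w => walk t w).
Proof. by apply: measurable_sum => k; exact: measurable_walk_increment. Qed.

Lemma measurable_likelihood_ratio d t n :
  measurable_fun [set: history R n] (fun w => likelihood_ratio d t w).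
Proof.
apply: measurable_prod => k _; apply: measurable_funD => //.
by apply: measurable_funM => //; exact: measurable_walk_increment.
Qed.

Lemma toss_sqr x : toss x ^+ 2 = 1.
Proof. by rewrite /toss; case: ifP => _; rewrite ?sqrrN expr1n. Qed.

Lemma likelihood_ratio_ge0 d t n (w : history R n) : `|d| <= 1 ->
  0 <= likelihood_ratio d t w.
Proof.
move=> d1; apply: prodr_ge0 => k _.
move: d1; rewrite ler_norml => /andP[? ?].
by rewrite /toss; case: observed; case: ifP => _ /=; rewrite ?(mulr0, mulr1); lra.
Qed.

End observations.

(** * Change of measure between fair and biased coins *)

Section change_of_measure.
Context (R : realType) (A : nat) (pi : strategy R A) (a : 'I_A).

Definition fair (b : 'I_A) : R := 2^-1.

(** Scaled so that the likelihood factors are exactly 1 + d and 1 - d; the mean of [a] is then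
    shifted by d/2. *)
Definition biased (d : R) (b : 'I_A) : R := if b == a then (1 + d) / 2 else 2^-1.

Let P0 := bandit_law (coin_instance fair) pi.
Let Pd d := bandit_law (coin_instance (biased d)) pi.

Lemma fair01 b : 0 <= fair b <= 1.
Proof. by rewrite /fair; apply/andP; split; lra. Qed.

Lemma biased01 d b : `|d| <= 1 -> 0 <= biased d b <= 1.
Proof.
rewrite ler_norml /biased => /andP[? ?]; case: ifP => _; apply/andP; split; lra.
Qed.

Lemma toss1 : toss (1 : R) = 1. Proof. by rewrite /toss eqxx. Qed.

Lemma toss0 : toss (0 : R) = -1.
Proof. by rewrite /toss eq_sym oner_eq0. Qed.

Local Open Scope ereal_scope.

(* The likelihood ratio ignores the rewards that were not queried, so the identity
   only holds for functions of the information. *)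
Lemma change_of_measure d n (g : history R n -> \bar R) : (`|d| <= 1)%R ->
  measurable_fun [set: history R n] g -> (forall h, 0 <= g h) ->
  \int[Pd d n]_w g (info pi w n) =
  \int[P0 n]_w (g (info pi w n) * (likelihood_ratio pi a d n w)%:E).
Proof.
move=> d1; elim: n g => [|n IH] g mg g0.
  by apply: eq_integral => w _; rewrite /likelihood_ratio big_ord0 mule1.
pose f h (z : R * R) := g (snoc h (z.1 * (decide pi h).2%:R, z.2)%R).
have mf : measurable_fun [set: history R n * (R * R)] (fun p => f p.1 p.2).
  apply: (measurableT_comp mg); apply: measurable_snoc => //.
  apply/measurable_fun_pairP; split; last first.
    exact: (measurableT_comp measurable_snd measurable_snd).
  apply: measurable_funM.
    exact: (measurableT_comp measurable_fst measurable_snd).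
  exact: (measurableT_comp
    (@measurable_fun_decide R A pi n _ R (fun x => x.2%:R))
    measurable_fst).
have mfh h : measurable_fun [set: R * R] (f h).
  exact: (measurableT_comp mf (measurable_fun_pair _ _)).
have f0 h z : 0 <= f h z by exact: g0.
(* Averaging [g] over round n + 1 leaves a function of the information after n rounds, to which the
   induction hypothesis applies. *)
pose G h := \int[round_law (coin_instance (biased d)) (decide pi h).1]_z f h z.
have mG : measurable_fun [set: history R n] G.
  apply: (@measurable_integral_select _ _ _ _ R _ (fun h => (decide pi h).1)
    (round_law (coin_instance (biased d))) f) => // i.
  exact: (@measurable_decide _ _ pi n [set x | x.1 = i]).
have G0 h : 0 <= G h by exact: integral_ge0.
have mginfo : measurable_fun [set: history R n.+1] (fun w => g (info pi w n.+1)).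
  exact: (measurableT_comp mg (@measurable_info R A pi n.+1 n.+1)).
have mL m k := @measurable_likelihood_ratio R A pi a d m k.
rewrite [LHS]ge0_integral_bandit_lawS// [RHS]ge0_integral_bandit_lawS//;
  last 2 first.
- by apply: emeasurable_funM; [|apply/measurable_EFinP; exact: mL].
- by move=> w; rewrite mule_ge0// lee_fin likelihood_ratio_ge0.
transitivity (\int[Pd d n]_w G (info pi w n)).
  apply: eq_integral => w _; apply: eq_integral => z _.
  by rewrite info_snoc_last.
rewrite IH//; apply: eq_integral => w _.
set h := info pi w n; set L := likelihood_ratio pi a d n w.
set o : R := (observed pi a w n)%:R.
have L0 : (0 <= L)%R by exact: likelihood_ratio_ge0.
under [RHS]eq_integral.
  move=> z _; rewrite info_snoc_last likelihood_ratio_snoc -/h -/L -/o.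
  rewrite -[g _]/(f h z).
  over.
have o1 x : (0 <= 1 + d * (toss x * o))%R.
  move: d1; rewrite ler_norml => /andP[? ?].
  by rewrite /toss /o; case: observed; case: ifP => _ /=;
    rewrite ?(mulr0, mulr1); lra.
rewrite [RHS]ge0_integral_round_coin ?fair01//; last 2 first.
- apply: emeasurable_funM => //; apply/measurable_EFinP.
  apply: measurable_funM => //; apply: measurable_funD => //.
  apply: measurable_funM => //; apply: measurable_funM => //.
  exact: (measurableT_comp (@measurable_toss R) measurable_fst).
- by move=> z; rewrite mule_ge0// lee_fin mulr_ge0.
rewrite /G ge0_integral_round_coin//; last exact: biased01.
have mfu x : measurable_fun [set: R] (fun u => f h (x, u)).
  exact: (measurableT_comp (mfh h) (measurable_fun_pair _ _)).
rewrite /= !ge0_integralZr// ?lee_fin ?mulr_ge0//.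
set X1 := \int[_]_x f h (1%R, x); set X0 := \int[_]_x f h (0%R, x).
have X10 : 0 <= X1 by exact: integral_ge0.
have X00 : 0 <= X0 by exact: integral_ge0.
rewrite toss1 toss0 ge0_muleDl; last 2 first.
- by rewrite mule_ge0// lee_fin; case/andP: (biased01 (decide pi h).1 d1).
- by rewrite mule_ge0// lee_fin subr_ge0; case/andP: (biased01 (decide pi h).1 d1).
rewrite [X1 * _]muleC [X0 * _]muleC !muleA !(muleAC _ _ L%:E) -!EFinM.
have oE : o = (((decide pi h).1 == a) && (decide pi h).2)%:R by [].
(* If the round is queried, the weights of [X1] and [X0] agree separately on both sides. *)
have [q1|q0] := boolP (decide pi h).2.
  rewrite oE q1 andbT /biased /fair.
  by case: eqP => _ /=; congr (_%:E * _ + _%:E * _); field.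
(* Without a query the agent sees 0 for either reward, so only the total weight of the two outcomes
   counts, and it is [L] on both sides. *)
have X1E : X1 = X0.
  by apply: eq_integral => u _; rewrite /f (negbTE q0) !mulr0.
rewrite oE (negbTE q0) andbF X1E !mulr0 !addr0 /fair -!ge0_muleDl.
- by rewrite -!EFinD; congr (_%:E * _); field.
- by rewrite lee_fin mulr_ge0//; lra.
- by rewrite lee_fin mulr_ge0//; lra.
- by rewrite lee_fin mulr_ge0//; case/andP: (biased01 (decide pi h).1 d1).
- rewrite lee_fin mulr_ge0// subr_ge0.
  by case/andP: (biased01 (decide pi h).1 d1).
Qed.

(** Orthogonality of martingale increments: averaging (S + o)^2 and (S - o)^2 cancels the cross term
    and leaves S^2 + o, as o is 0 or 1. *)
Lemma ge0_integral_walk_sqr n :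
  \int[P0 n]_w (walk pi a n w ^+ 2)%:E = \int[P0 n]_w (observations pi a n w)%:E.
Proof.
elim: n => [|n IH].
  by apply: eq_integral => w _; rewrite /walk /observations !big_ord0 expr0n.
have mwalk m k := @measurable_walk R A pi a m k.
have mobs m k := @measurable_observations R A pi a m k.
have obs0 m k (w : history R k) : (0 <= observations pi a m w)%R.
  by apply: sumr_ge0 => i _.
(* Whether round n + 1 is observed is already decided by the first n rounds, so the count may be
   integrated under the law of n rounds. *)
rewrite [RHS](@ge0_integral_bandit_law_prefix _ _ _ _
  (fun k w => (observations pi a n.+1 w)%:E) n)//; last 3 first.
- by move=> k; apply/measurable_EFinP; exact: mobs.
- by move=> k w; rewrite lee_fin.
- by move=> k w z nk; rewrite observations_snoc.
rewrite [LHS]ge0_integral_bandit_lawS//; last 2 first.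
- by apply/measurable_EFinP; apply: measurable_funX; exact: mwalk.
- by move=> w; rewrite lee_fin sqr_ge0.
transitivity (\int[P0 n]_w ((walk pi a n w ^+ 2)%:E + (observed pi a w n)%:R%:E)).
  apply: eq_integral => w _.
  under eq_integral do rewrite walk_snoc.
  rewrite ge0_integral_round_coin ?fair01//; last 2 first.
  - apply/measurable_EFinP; apply: measurable_funX; apply: measurable_funD => //.
    apply: measurable_funM => //.
    exact: (measurableT_comp (@measurable_toss R) measurable_fst).
  - by move=> z; rewrite lee_fin sqr_ge0.
  have cst1 := integral_probability_cst (unif01 R).
  rewrite (cst1 ((walk pi a n w + toss 1 * (observed pi a w n)%:R) ^+ 2)%R).
  rewrite (cst1 ((walk pi a n w + toss 0 * (observed pi a w n)%:R) ^+ 2)%R).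
  rewrite toss1 toss0 /fair.
  rewrite -!EFinM -!EFinD; congr EFin.
  by case: observed; rewrite /= ?(mulr1, mulr0); field.
have mo : measurable_fun [set: history R n] (fun w => (observed pi a w n)%:R : R).
  exact: measurable_observed.
rewrite ge0_integralD//; last 3 first.
- by move=> w _; rewrite lee_fin sqr_ge0.
- by apply/measurable_EFinP; apply: measurable_funX; exact: mwalk.
- exact/measurable_EFinP.
rewrite IH -ge0_integralD//; last 3 first.
- by move=> w _; rewrite lee_fin.
- by apply/measurable_EFinP; exact: mobs.
- exact/measurable_EFinP.
by apply: eq_integral => w _; rewrite /observations big_ord_recr.
Qed.

End change_of_measure.

(** * Pointwise lower bound on the likelihood ratio *)

Section likelihood_lower_bound.
Context (R : realType) (A : nat) (pi : strategy R A) (a : 'I_A).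
Implicit Types d : R.

(** With y = x - 2 x^2, use exp(-y) >= 1 - y and (1 + x)(1 - y) = 1 + x^2 (1 + 2 x) >= 1. *)
Lemma expR_le_1D (x : R) : `|x| <= 2^-1 -> expR (x - 2 * x ^+ 2) <= 1 + x.
Proof.
rewrite ler_norml => /andP[x1 x2].
set y := x - _; have e1 := expR_ge1Dx (- y).
have x1_ge0 : 0 <= 1 + x by lra.
rewrite -[y]opprK expRN -div1r ler_pdivrMr ?expR_gt0//.
apply: le_trans (ler_wpM2l x1_ge0 e1); rewrite -subr_ge0.
rewrite (_ : _ - 1 = x ^+ 2 * (1 + 2 * x)); last by rewrite /y; ring.
by rewrite mulr_ge0 ?sqr_ge0//; lra.
Qed.

(** Bound each factor below by [expR_le_1D]; the squared increments add up to the number of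
    observations. Then apply exp(u) >= 1 + u to the product of the exponentials. *)
Lemma likelihood_ratio_ge d t n (w : history R n) : `|d| <= 2^-1 ->
  1 + d * walk pi a t w - 2 * d ^+ 2 * observations pi a t w <=
  likelihood_ratio pi a d t w.
Proof.
move=> d2.
suff: expR (d * walk pi a t w - 2 * d ^+ 2 * observations pi a t w) <=
    likelihood_ratio pi a d t w.
  by apply: le_trans; rewrite -addrA expR_ge1Dx.
rewrite /walk /observations /likelihood_ratio.
elim: t => [|t IH]; first by rewrite !big_ord0 !mulr0 subr0 expR0.
rewrite !big_ord_recr/=.
set S := \sum_(i < t) toss _ * _ in IH *.
set N := \sum_(i < t) (observed pi a w i)%:R in IH *.
set x := toss _ * _; set o : R := (observed pi a w t)%:R.
rewrite (_ : _ - _ = (d * S - 2 * d ^+ 2 * N) + (d * x - 2 * (d * x) ^+ 2)).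
  rewrite expRD; apply: ler_pM;
    [exact: expR_ge0|exact: expR_ge0|exact: IH|apply: expR_le_1D].
  rewrite normrM (le_trans _ d2)// ler_piMr// /x /toss.
  by case: observed; case: ifP => _;
    rewrite /= ?(mulr0, mulr1, normrN, normr0, normr1).
have : x ^+ 2 = o.
  by rewrite /x exprMn toss_sqr mul1r /o; case: observed; rewrite ?expr1n ?expr0n.
by move=> <-; ring.
Qed.

End likelihood_lower_bound.

(** * Indistinguishability of the best and the worst arm *)

Section two_point.
Context (R : realType) (A : nat) (pi : strategy R A).

(** Real-valued so that the final estimates are linear arithmetic over the reals; the integral is
    finite because its integrand is bounded. *)
Definition decision_prob (nu : bandit_instance R A) (T k : nat)
    (phi : pred 'I_A) : R :=
  fine (\int[bandit_law nu pi T]_w (phi (arm pi w k))%:R%:E)%E.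

Definition expected_observations (nu : bandit_instance R A) (T t : nat)
    (a : 'I_A) : R :=
  fine (\int[bandit_law nu pi T]_w (observations pi a t w)%:E)%E.

Lemma measurable_arm_fun n k (f : 'I_A -> R) :
  measurable_fun [set: history R n] (fun w => f (arm pi w k)).
Proof. exact: (@measurable_decision R A pi n _ R (fun x => f x.1)). Qed.

Lemma observations_ge0 a t n (w : history R n) : 0 <= observations pi a t w.
Proof. by apply: sumr_ge0. Qed.

Lemma observations_le a t n (w : history R n) : observations pi a t w <= t%:R.
Proof.
rewrite -[leRHS]mulr1 mulr_natl -[X in _ *+ X]card_ord -sumr_const ler_sum// => k _.
by case: observed.
Qed.

Local Open Scope ereal_scope.

Lemma bounded_integral_fin_num d (T : measurableType d) (P : probability T R)
    (f : T -> R) (M : R) :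
  measurable_fun [set: T] f -> (forall x, 0 <= f x <= M)%R ->
  \int[P]_x (f x)%:E \is a fin_num.
Proof.
move=> mf fM; rewrite ge0_fin_numE; last first.
  by apply: integral_ge0 => x _; rewrite lee_fin; case/andP: (fM x).
apply: (@le_lt_trans _ _ (\int[P]_x M%:E)).
  apply: ge0_le_integral => //.
  - by move=> x _; rewrite lee_fin; case/andP: (fM x).
  - exact/measurable_EFinP.
  - by move=> x _; rewrite lee_fin; case/andP: (fM x).
rewrite integral_cst//; apply: lte_mul_pinfty => //.
  by rewrite lee_fin; case/andP: (fM point) => /le_trans; apply.
by rewrite (le_lt_trans (probability_le1 _ _))// ltry.
Qed.

Lemma decision_probE nu T k phi : (decision_prob nu T k phi)%:E =
  \int[bandit_law nu pi T]_w (phi (arm pi w k))%:R%:E.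
Proof.
rewrite fineK//; apply: (@bounded_integral_fin_num _ _ _ _ 1%R).
  exact: (measurable_arm_fun _ (fun b => (phi b)%:R)).
by move=> w; case: phi; rewrite /= ?lexx ?ler01.
Qed.

Lemma expected_observationsE nu T t a : (expected_observations nu T t a)%:E =
  \int[bandit_law nu pi T]_w (observations pi a t w)%:E.
Proof.
rewrite fineK//; apply: (@bounded_integral_fin_num _ _ _ _ t%:R).
  exact: measurable_observations.
by move=> w; rewrite observations_ge0 observations_le.
Qed.

Variable a : 'I_A.

(* Both error terms come from completing the square in
   [likelihood_ratio >= 1 + d S - 2 d^2 N], with
   [d S + 2 d^2 S^2 + 1/8 = 2 (d S + 1/4)^2]. *)
Lemma decision_prob_biased (d : R) n (phi : pred 'I_A) : (`|d| <= 2^-1)%R ->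
  \int[bandit_law (coin_instance (@fair R A)) pi n]_w (phi (arm pi w n))%:R%:E <=
  \int[bandit_law (coin_instance (biased a d)) pi n]_w (phi (arm pi w n))%:R%:E +
  8^-1%:E + (4 * d ^+ 2)%:E *
  \int[bandit_law (coin_instance (@fair R A)) pi n]_w (observations pi a n w)%:E.
Proof.
move=> d2; have d1 : (`|d| <= 1)%R by rewrite (le_trans d2)//; lra.
set P0 := bandit_law (coin_instance (@fair R A)) pi n.
pose g (h : history R n) : \bar R := (phi (decide pi h).1)%:R%:E.
have mg : measurable_fun [set: history R n] g.
  apply/measurable_EFinP.
  exact: (@measurable_fun_decide R A pi n _ R (fun x => (phi x.1)%:R)).
rewrite (_ : \int[bandit_law (coin_instance (biased a d)) pi n]_w _ =
    \int[bandit_law (coin_instance (biased a d)) pi n]_w g (info pi w n))//.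
rewrite change_of_measure//; last by move=> h; rewrite lee_fin.
have mobs := @measurable_observations R A pi a n n.
have mwalk := @measurable_walk R A pi a n n.
have mL := @measurable_likelihood_ratio R A pi a d n n.
have mphi : measurable_fun [set: history R n] (fun w => (phi (arm pi w n))%:R : R).
  exact: (measurable_arm_fun _ (fun b => (phi b)%:R)).
have d20 : (0 <= 2 * d ^+ 2)%R by rewrite mulr_ge0// sqr_ge0.
(* Half of the count is traded for the second moment of the walk, after which the inequality holds
   pointwise under the fair law. *)
rewrite (_ : (4 * d ^+ 2)%:E * _ =
    (2 * d ^+ 2)%:E * (\int[P0]_w (walk pi a n w ^+ 2)%:E) +
    (2 * d ^+ 2)%:E * (\int[P0]_w (observations pi a n w)%:E)); last first.
  rewrite ge0_integral_walk_sqr -ge0_muleDl ?lee_fin// -EFinD.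
  by congr (_%:E * _); ring.
rewrite -!ge0_integralZl//; last 4 first.
- exact/measurable_EFinP.
- by move=> w _; rewrite lee_fin observations_ge0.
- by apply/measurable_EFinP; exact: measurable_funX.
- by move=> w _; rewrite lee_fin sqr_ge0.
rewrite -(integral_probability_cst P0 8^-1).
have m1 : measurable_fun [set: history R n]
    (fun w => (g (info pi w n) * (likelihood_ratio pi a d n w)%:E)).
  by apply: emeasurable_funM; exact/measurable_EFinP.
have L0 (w : history R n) : 0 <= g (info pi w n) * (likelihood_ratio pi a d n w)%:E.
  by rewrite mule_ge0// ?lee_fin// likelihood_ratio_ge0.
have S0 (w : history R n) : 0 <= (2 * d ^+ 2)%:E * (walk pi a n w ^+ 2)%:E.
  by rewrite mule_ge0// lee_fin// sqr_ge0.
have N0 (w : history R n) : 0 <= (2 * d ^+ 2)%:E * (observations pi a n w)%:E.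
  by rewrite mule_ge0// lee_fin// observations_ge0.
have mS : measurable_fun [set: history R n]
    (fun w => (2 * d ^+ 2)%:E * (walk pi a n w ^+ 2)%:E).
  by apply/measurable_EFinP; apply: measurable_funM => //; exact: measurable_funX.
have mN : measurable_fun [set: history R n]
    (fun w => (2 * d ^+ 2)%:E * (observations pi a n w)%:E).
  by apply/measurable_EFinP; exact: measurable_funM.
rewrite -!ge0_integralD//; last 4 first.
- by move=> w _; rewrite adde_ge0// lee_fin.
- exact: emeasurable_funD.
- by move=> w _; rewrite adde_ge0.
- exact: emeasurable_funD.
apply: ge0_le_integral => //.
- exact/measurable_EFinP.
- by apply: emeasurable_funD; exact: emeasurable_funD.
move=> w _; rewrite /g -!EFinM -!EFinD lee_fin.
rewrite -[(decide pi (info pi w n)).1]/(arm pi w n).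
have := likelihood_ratio_ge pi a n w d2.
have := observations_ge0 a n w.
have := @likelihood_ratio_ge0 R A pi a d n n w d1.
set L := likelihood_ratio _ _ _ _ _; set N := observations _ _ _ _.
set S := walk _ _ _ _ => L1 N1 LSN.
have Q : (0 <= 2 * (d * S + 4^-1) ^+ 2)%R by rewrite mulr_ge0// sqr_ge0.
have -> : ((phi (arm pi w n))%:R * L + 8^-1 +
    (2 * d ^+ 2 * S ^+ 2 + 2 * d ^+ 2 * N) =
    (phi (arm pi w n))%:R * L - d * S + 2 * d ^+ 2 * N +
    2 * (d * S + 4^-1) ^+ 2)%R by field.
(* If [phi] fails, the right side is a sum of nonnegative terms; if it holds, the bounds [LSN] and
   [Q] suffice. *)
case: (phi _); rewrite /= ?(mul1r, mul0r); last first.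
  rewrite sub0r; have := mulr_ge0 d20 N1.
  rewrite (_ : (- (d * S) + _ + _ = 2 * d ^+ 2 * N + (2 * d ^+ 2 * S ^+ 2 + 8^-1))%R);
    last by field.
  by move=> ?; rewrite !addr_ge0// mulr_ge0// sqr_ge0.
lra.
Qed.

(** Under fair coins the events of missing and playing [a] have total probability 1. Moving the
    first to bias d and the second to bias -d doubles the error terms 1/8 and 4 d^2 N. *)
Lemma decision_prob_two_point d T k : (`|d| <= 2^-1)%R -> (k < T)%N ->
  (1 <= decision_prob (coin_instance (biased a d)) T k (predC1 a) +
    decision_prob (coin_instance (biased a (- d))) T k (pred1 a) + 4^-1 +
    8 * d ^+ 2 * expected_observations (coin_instance (@fair R A)) T k.+1 a)%R.
Proof.
move=> d2 kT; rewrite -lee_fin !EFinD EFinM !decision_probE expected_observationsE.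
have prefix nu (phi : pred 'I_A) : \int[bandit_law nu pi T]_w (phi (arm pi w k))%:R%:E =
    \int[bandit_law nu pi k]_w (phi (arm pi w k))%:R%:E.
  apply: (@ge0_integral_bandit_law_prefix _ _ nu pi
    (fun n w => (phi (arm pi w k))%:R%:E)) => //; first exact: ltnW.
  - move=> n; apply/measurable_EFinP.
    exact: (measurable_arm_fun _ (fun b => (phi b)%:R)).
  - by move=> n w z kn; rewrite arm_snoc.
have mobs n m := @measurable_observations R A pi a n m.
set P0 := bandit_law (coin_instance (@fair R A)) pi.
(* The choice in round k + 1 depends on k rounds, but the count is enlarged to k + 1 rounds because
   the budgets start at round 1. *)
have obsk : \int[P0 k]_w (observations pi a k w)%:E <=
    \int[P0 T]_w (observations pi a k.+1 w)%:E.
  rewrite -(@ge0_integral_bandit_law_prefix _ _ (coin_instance (@fair R A)) pi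
    (fun n w => (observations pi a k w)%:E) k T (ltnW kT)) => //; last 3 first.
  - by move=> n; apply/measurable_EFinP; exact: mobs.
  - by move=> n w; rewrite lee_fin observations_ge0.
  - by move=> n w z kn; rewrite observations_snoc// ltnW.
  apply: ge0_le_integral => //.
  - by move=> w _; rewrite lee_fin observations_ge0.
  - by apply/measurable_EFinP; exact: mobs.
  - by apply/measurable_EFinP; exact: mobs.
  - by move=> w _; rewrite lee_fin /observations big_ord_recr/= lerDl.
rewrite !prefix.
have Nd2 : (`|- d| <= 2^-1)%R by rewrite normrN.
have := leeD (decision_prob_biased k (predC1 a) d2)
  (decision_prob_biased k (pred1 a) Nd2).
rewrite -ge0_integralD//; last 2 first.
- apply/measurable_EFinP.
  exact: (measurable_arm_fun _ (fun b => (predC1 a b)%:R)).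
- apply/measurable_EFinP.
  exact: (measurable_arm_fun _ (fun b => (pred1 a b)%:R)).
rewrite (eq_integral (fun=> 1%:E)); last first.
  by move=> w _; rewrite -EFinD /=; case: eqP; rewrite ?(addr0, add0r).
rewrite integral_probability_cst => /le_trans; apply.
rewrite sqrrN -/(P0 k).
set p := \int[bandit_law (coin_instance (biased a d)) pi k]_w _.
set q := \int[bandit_law (coin_instance (biased a (- d))) pi k]_w _.
set N := \int[P0 k]_w _ in obsk *.
have N0 : 0 <= N by apply: integral_ge0 => w _; rewrite lee_fin observations_ge0.
have d20 : (0 <= 4 * d ^+ 2)%R by rewrite mulr_ge0// sqr_ge0.
rewrite addeACA (addeACA p) -EFinD -ge0_muleDl ?lee_fin// -EFinD.
rewrite (_ : 8^-1 + 8^-1 = 4^-1)%R; last by field.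
rewrite (_ : 4 * d ^+ 2 + 4 * d ^+ 2 = 8 * d ^+ 2)%R; last by ring.
by rewrite leeD2l// lee_wpmul2l// lee_fin mulr_ge0// sqr_ge0.
Qed.

End two_point.

(** * Expected regret and expected query cost *)

Section regret.
Context (R : realType) (A : nat) (pi : strategy R A).

Lemma expected_regret_ge (nu : bandit_instance R A) T s (x : R) (phi : pred 'I_A) :
  (s <= T)%N -> 0 <= x ->
  (forall b, x * (phi b)%:R <= max_mean nu - mean nu b) ->
  ((x * \sum_(k < s) decision_prob pi nu T k phi)%:E <=
   'E_(bandit_law nu pi T) [regret pi nu T (n := T)])%E.
Proof.
move=> sT x0 xphi.
have mphi (k : nat) :
    measurable_fun [set: history R T] (fun w => (phi (arm pi w k))%:R : R).
  exact: (measurable_arm_fun _ _ (fun b => (phi b)%:R)).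
rewrite EFinM -sumEFin; under eq_bigr do rewrite decision_probE.
rewrite -ge0_integral_sum//; last first.
  by move=> k; apply/measurable_EFinP; exact: mphi.
have msum : measurable_fun [set: history R T]
    (fun w => \sum_(k < s) (phi (arm pi w k))%:R%:E : \bar R)%E.
  by apply: emeasurable_sum => k; apply/measurable_EFinP; exact: mphi.
rewrite -ge0_integralZl//; last by move=> w _; rewrite sume_ge0// => k _; rewrite lee_fin.
have diff0 b : 0 <= max_mean nu - mean nu b.
  by apply: le_trans (xphi b); rewrite mulr_ge0.
rewrite expectation.unlock; apply: ge0_le_integral => //.
- by move=> w _; rewrite mule_ge0// ?lee_fin// sume_ge0.
- exact: measurable_funeM.
- apply/measurable_EFinP; apply: measurable_sum => k.
  exact: (measurable_arm_fun _ _ (fun b => max_mean nu - mean nu b)).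
move=> w _; rewrite sumEFin -EFinM lee_fin mulr_sumr /regret.
rewrite (big_ord_widen T (fun k => x * (phi (arm pi w k))%:R) sT) big_mkcond.
by apply: ler_sum => k _; case: ifP.
Qed.

End regret.

Section query_cost.
Context (R : realType) (A : nat) (pi : strategy R A).

Lemma query_costE (c : 'I_A -> R) t n (w : history R n) :
  query_cost pi c t w = \sum_a c a * observations pi a t w.
Proof.
under [RHS]eq_bigr do rewrite mulr_sumr; rewrite exchange_big/=.
apply: eq_bigr => k _; rewrite (bigD1 (arm pi w k))//= big1 ?addr0 => [|a].
  by rewrite /observed eqxx.
by rewrite /observed eq_sym => /negbTE ->; rewrite mulr0.
Qed.

Lemma expected_query_cost (nu : bandit_instance R A) T t (c : 'I_A -> R) :
  (forall a, 0 <= c a) ->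
  ('E_(bandit_law nu pi T) [query_cost pi c t (n := T)] =
   (\sum_a c a * expected_observations pi nu T t a)%:E)%E.
Proof.
move=> c0; have mobs a := @measurable_observations R A pi a t T.
rewrite expectation.unlock -sumEFin.
under [RHS]eq_bigr => a _.
  rewrite EFinM expected_observationsE -ge0_integralZl//; first over.
  - by apply/measurable_EFinP; exact: mobs.
  - by move=> w _; rewrite lee_fin observations_ge0.
  - by rewrite lee_fin.
rewrite -ge0_integral_sum//; last 2 first.
- by move=> a; apply/measurable_EFinP; apply: measurable_funM => //; exact: mobs.
- by move=> a w _; rewrite mule_ge0// lee_fin ?observations_ge0.
by apply: eq_integral => w _; rewrite query_costE -sumEFin.
Qed.

End query_cost.

(** * Harmonic sums and the choice of the critical round *)

Section real_sums.
Context (R : realType).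

(** With q = 1/(T + 2), the induction step needs q <= -ln(1 - q), which is 1 + u <= exp(u) at u =
    ln(1 - q). *)
Lemma harmonic_le_ln (T : nat) : (0 < T)%N ->
  \sum_(1 <= t < T.+1) t%:R^-1 <= 1 + ln T%:R :> R.
Proof.
elim: T => [//|[_ _|T IH _]]; first by rewrite big_nat1 invr1 ln1 addr0.
rewrite big_nat_recr//= (le_trans (lerD (IH _) (lexx _)))// -addrA lerD2l.
have T1 : (0 : R) < T.+1%:R by rewrite ltr0n.
have T2 : (0 : R) < T.+2%:R by rewrite ltr0n.
have -> : T.+1%:R = T.+2%:R * (1 - T.+2%:R^-1) :> R.
  by rewrite mulrBr mulr1 divff ?gt_eqF// -[in RHS]natr1 addrK.
have q0 : (0 : R) < 1 - T.+2%:R^-1.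
  by rewrite subr_gt0 invf_lt1// ltr1n.
rewrite lnM ?posrE// -addrA gerDl addrC.
have := @expR_ge1Dx R (ln (1 - T.+2%:R^-1)).
by rewrite lnK ?posrE//; move: (T.+2%:R^-1) => q; lra.
Qed.

(** For the s maximising s m_s, each m_t is at most s m_s / t, and the harmonic sum remains. In the
    proof the ordinal i stands for round i + 1. *)
Lemma sum_le_max_partial (T : nat) (m : nat -> R) : (0 < T)%N ->
  (forall t, (1 <= t <= T)%N -> 0 <= m t) ->
  exists2 s, (1 <= s <= T)%N &
    \sum_(1 <= t < T.+1) m t <= (1 + ln T%:R) * (s%:R * m s).
Proof.
move=> T0 m0.
have [i _ imax] : exists2 i : 'I_T, true &
    forall j : 'I_T, j.+1%:R * m j.+1 <= i.+1%:R * m i.+1.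
  case: (@Order.TotalTheory.arg_maxP _ _ 'I_T (Ordinal T0) xpredT
    (fun i : 'I_T => i.+1%:R * m i.+1)) => // i _ imax.
  by exists i => // j; exact: imax.
exists i.+1; first by rewrite ltn_ord.
have im0 : 0 <= i.+1%:R * m i.+1 by rewrite mulr_ge0// m0// ltn_ord.
apply: le_trans (ler_wpM2r im0 (harmonic_le_ln T0)).
rewrite mulr_suml; apply: ler_sum_nat => -[//|t] /andP[_ tT].
rewrite ler_pdivlMl ?ltr0n//.
exact: (imax (Ordinal (tT : (t < T)%N))).
Qed.

End real_sums.

(** * Regret in the biased instances *)

Section biased_regret.
Context (R : realType) (A : nat) (pi : strategy R A) (a : 'I_A).

Lemma mean_le_max (nu : bandit_instance R A) b : mean nu b <= max_mean nu.
Proof. by rewrite /max_mean; exact: le_bigmax. Qed.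

Lemma regret_biased_up T s (d : R) : (s <= T)%N -> 0 <= d <= 1 ->
  ((d / 2 * \sum_(k < s)
      decision_prob pi (coin_instance (biased a d)) T k (predC1 a))%:E <=
   'E_(bandit_law (coin_instance (biased a d)) pi T)
     [regret pi (coin_instance (biased a d)) T (n := T)])%E.
Proof.
move=> sT /andP[d0 d1]; have nd : `|d| <= 1 by rewrite ger0_norm.
apply: expected_regret_ge => //; first by rewrite divr_ge0.
move=> b; have := mean_le_max (coin_instance (biased a d)) a.
rewrite !mean_coin ?biased01// /biased eqxx /=.
by case: eqP => _ /=; lra.
Qed.

Lemma regret_biased_down T s (d : R) : (1 < A)%N -> (s <= T)%N -> 0 <= d <= 1 ->
  ((d / 2 * \sum_(k < s)
      decision_prob pi (coin_instance (biased a (- d))) T k (pred1 a))%:E <=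
   'E_(bandit_law (coin_instance (biased a (- d))) pi T)
     [regret pi (coin_instance (biased a (- d))) T (n := T)])%E.
Proof.
move=> A1 sT /andP[d0 d1]; have nd : `|- d| <= 1 by rewrite normrN ger0_norm.
apply: expected_regret_ge => //; first by rewrite divr_ge0.
(* At least two arms: some other arm has mean 1/2, so playing [a] loses d/2. *)
have [b' b'a] : exists b' : 'I_A, b' != a.
  have : (0 < #|predC1 a|)%N by rewrite cardC1 card_ord -subn1 subn_gt0.
  by case/card_gt0P => b'; rewrite !inE; exists b'.
move=> b; have := mean_le_max (coin_instance (biased a (- d))) b'.
rewrite !mean_coin ?biased01// /biased (negbTE b'a) /=.
by case: eqP => _ /=; lra.
Qed.

End biased_regret.

(** * Averaging over the arms with weights c(a) *)

Theorem corollary3 (R : realType) (T A : nat) (c : 'I_A -> R) (B : nat -> R)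
    (pi : strategy R A)
    (hT : (0 < T)%N) (hA : (2 <= A)%N)
    (hc : forall a : 'I_A, 0 <= c a)
    (hB : forall t : nat, (1 <= t <= T)%N -> 0 < B t)
    (hBmono : forall s t : nat, (1 <= s)%N -> (s <= t)%N -> (t <= T)%N -> B s <= B t)
    (hbudget : forall (nu : bandit_instance R A) (t : nat), (1 <= t <= T)%N ->
       ('E_(bandit_law nu pi T) [query_cost pi c t (n := T)] <= (B t)%:E)%E) :
  exists nu : bandit_instance R A,
    (((140 * (1 + ln T%:R))^-1 *
        \sum_(1 <= t < T.+1)
          Num.min (Num.sqrt ((\sum_(a < A) c a) / (B t * (1 + ln A%:R)))) 1)%:E
     <= 'E_(bandit_law nu pi T) [regret pi nu T (n := T)])%E.
Proof.
set C := \sum_(a < A) c a; set tau := _^-1 * _.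
have C0 : 0 <= C by apply: sumr_ge0.
(* If all costs vanish, the target is 0 and nonnegativity of the regret is enough. *)
have [Cz|Cn0] := eqVneq C 0.
  exists (coin_instance (@fair R A)).
  rewrite /tau big1 ?mulr0; last first.
    by move=> t _; rewrite Cz mul0r sqrtr0 min_l.
  have := @expected_regret_ge R A pi (coin_instance (@fair R A)) T 0 0 xpred0.
  rewrite big_ord0 mulr0; apply => // b.
  by rewrite ?mul0r subr_ge0 mean_le_max.
have Cpos : 0 < C by rewrite lt_def Cn0.
pose m t := Num.min (Num.sqrt (C / B t)) 1.
have m_gt0 t : (1 <= t <= T)%N -> 0 < m t.
  by move=> tT; rewrite lt_min ltr01 andbT sqrtr_gt0 divr_gt0// hB.
have [s sT msum] := sum_le_max_partial hT (fun t h => ltW (m_gt0 t h)).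
(* Small enough for the likelihood bound, as d <= 1/8, and such that 8 d^2 B(s) <= C/8, by [d2B]. *)
pose d := m s / 8.
have ms0 : 0 < m s by exact: m_gt0.
have ms1 : m s <= 1 by rewrite ge_min lexx orbT.
have d01 : 0 <= d <= 1 by rewrite /d; apply/andP; split; lra.
have nd : `|d| <= 2^-1 by rewrite ger0_norm /d; lra.
have /andP[s0 sleT] := sT.
have sR : 1 <= s%:R :> R by rewrite ler1n.
have d2B : 64 * d ^+ 2 * B s <= C.
  rewrite -ler_pdivlMr ?hB// (_ : 64 * d ^+ 2 = m s ^+ 2); last by rewrite /d; field.
  rewrite -[leRHS]sqr_sqrtr ?divr_ge0// ?(ltW (hB _ sT))//.
  by rewrite ler_pXn2r ?nnegrE ?sqrtr_ge0 ?(ltW ms0)// ge_min lexx.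
have lnT : 0 < 1 + ln T%:R :> R by rewrite ltr_pwDl// ln_ge0// ler1n.
have lnA : 1 <= 1 + ln A%:R :> R by rewrite lerDl ln_ge0// ler1n ltnW.
(* Replacing 1 + ln A by 1 can only increase the minimum, so each summand is at most m t. *)
have tau_le : tau <= 140^-1 * (s%:R * m s).
  rewrite /tau invfM -mulrA ler_wpM2l ?invr_ge0// ler_pdivrMl//.
  apply: le_trans msum; apply: ler_sum_nat => t tT.
  have Bt : 0 < B t by exact: hB.
  rewrite /m le_min !ge_min lexx !orbT andbT; apply/orP; left.
  rewrite ler_wsqrtr// ler_wpM2l// lef_pV2 ?posrE ?mulr_gt0//; last exact: lt_le_trans lnA.
  by rewrite ler_peMr// ltW.
have [nuP|/forallNP noreg] := pselect (exists nu : bandit_instance R A,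
    (tau%:E <= 'E_(bandit_law nu pi T) [regret pi nu T (n := T)])%E); first by [].
(* Argue by contradiction: if no instance reaches [tau], then [tau] bounds the regret in all biased
   instances at once. *)
have reglt x nu : (x%:E <= 'E_(bandit_law nu pi T) [regret pi nu T (n := T)])%E ->
    x <= tau.
  move=> xreg; rewrite -lee_fin (le_trans xreg)// leNgt; apply/negP => /ltW.
  exact: noreg.
pose p a k := decision_prob pi (coin_instance (biased a d)) T k (predC1 a).
pose q a k := decision_prob pi (coin_instance (biased a (- d))) T k (pred1 a).
pose N a k := expected_observations pi (coin_instance (@fair R A)) T k a.
have upper a : d / 2 * \sum_(k < s) (p a k + q a k) <= 2 * tau.
  rewrite big_split/= mulrDr [leRHS]mulr_natl mulr2n.
  apply: lerD; apply: reglt; first exact: regret_biased_up.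
  exact: regret_biased_down.
(* Here 5/8 = 3/4 - 1/8: the two-point bound leaves 1 - 1/4, and the weighted counts at round k + 1
   <= s are at most B(s), costing C/8. *)
have lower (k : 'I_s) : 5 / 8 * C <= \sum_a c a * (p a k + q a k).
  have ks : (k < T)%N by rewrite (leq_trans (ltn_ord k)).
  have : \sum_a c a * N a k.+1 <= B s.
    rewrite -lee_fin -expected_query_cost//.
    by apply: le_trans (hbudget _ _ _) _ => //; rewrite lee_fin hBmono.
  move=> /(ler_wpM2l (_ : 0 <= 8 * d ^+ 2)) => /(_ ltac:(by rewrite mulr_ge0 ?sqr_ge0)).
  rewrite mulr_sumr => budget.
  have : \sum_a (c a * (3 / 4) - 8 * d ^+ 2 * (c a * N a k.+1)) <=
      \sum_a c a * (p a k + q a k).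
    apply: ler_sum => a _.
    rewrite [8 * _ * _]mulrCA -mulrBr ler_wpM2l//.
    have := decision_prob_two_point pi a nd ks.
    by rewrite -/(p a k) -/(q a k) -/(N a k.+1); lra.
  rewrite sumrB -mulr_suml -/C; lra.
have : d / 2 * (s%:R * (5 / 8 * C)) <= C * (2 * tau).
  have -> : s%:R * (5 / 8 * C) = \sum_(k < s) 5 / 8 * C.
    by rewrite sumr_const card_ord -[RHS]mulr_natl.
  apply: (@le_trans _ _ (\sum_a c a * (d / 2 * \sum_(k < s) (p a k + q a k)))).
    under [leRHS]eq_bigr do rewrite mulrCA mulr_sumr.
    rewrite -[leRHS]mulr_sumr exchange_big/= ler_wpM2l ?divr_ge0 ?(ltW ms0)//.
    by apply: ler_sum => k _; exact: lower.
  by rewrite mulr_suml; apply: ler_sum => a _; rewrite ler_wpM2l.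
(* This gives 5/128 s m_s <= 2 tau <= s m_s / 70, which is absurd since s m_s > 0 and 1/70 <
   5/128. *)
rewrite (_ : d / 2 * _ = C * (5 / 128 * (s%:R * m s))); last by rewrite /d; field.
rewrite ler_pM2l// => contra.
have : 0 < s%:R * m s by rewrite mulr_gt0// (lt_le_trans _ sR).
lra.
Qed.
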